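(* Let $v\neq 18$. There exists a $3$-way $5$-homogeneous $(v,3,2)$ Steiner trade if and only if $v\ge 12$ and $v\equiv 0\pmod 3$.
   Context: Let $V$ be a finite set with $v$ elements and let $t<k<v$ be positive integers. A $\mu$-way $(v,k,t)$ trade $T=\{T_1,\dots,T_\mu\}$ of volume $m$ consists of $\mu$ pairwise disjoint collections $T_1,\dots,T_\mu$, each of $m$ blocks ($k$-subsets of $V$), such that every $t$-subset of $V$ is contained in the same number of blocks in each $T_i$. The foundation $\mathrm{found}(T)$ is the set of elements covered by the blocks. It is a Steiner trade if every $t$-subset of $\mathrm{found}(T)$ is in at most one block of each $T_i$, and $d$-homogeneous if every element of $V$ lies in exactly $d$ blocks of each $T_i$. *)

(* Defs.v *)
From mathcomp Require Import all_boot.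

Set Implicit Arguments.
Unset Strict Implicit.
Unset Printing Implicit Defensive.

(* The mu-way family T_1, ..., T_mu is indexed by 'I_mu, and the point set V
   is the whole finite type, so that v = #|V|. *)
Section Trades.

Variables (V : finType) (mu : nat).
Implicit Type T : 'I_mu -> {set {set V}}.

Definition block_count (C : {set {set V}}) (S : {set V}) : nat :=
  #|[set B in C | S \subset B]|.

Definition is_trade (k t m : nat) T : Prop :=
  [/\ 0 < t < k /\ k < #|V|,
      forall i j, i != j -> [disjoint T i & T j],
      forall i, #|T i| = m,
      forall i B, B \in T i -> #|B| = k
    & forall S : {set V}, #|S| = t ->
        forall i j, block_count (T i) S = block_count (T j) S].

Definition found T : {set V} := \bigcup_i cover (T i).

Definition is_steiner_trade (k t m : nat) T : Prop :=
  is_trade k t m T /\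
  forall S : {set V}, S \subset found T -> #|S| = t ->
    forall i, block_count (T i) S <= 1.

Definition homogeneous (d : nat) T : Prop :=
  forall (x : V) i, #|[set B in T i | x \in B]| = d.

End Trades.

Definition exists_homogeneous_steiner_trade (mu d v k t : nat) : Prop :=
  exists (V : finType) (m : nat) (T : 'I_mu -> {set {set V}}),
    [/\ #|V| = v, is_steiner_trade k t m T & homogeneous d T].

(* Main.v *)
(** Counting incident pairs (x, B) gives 5v = 3m, so 3 divides v; counting the
    pairs (y, B) with x, y in B and y <> x for a fixed x gives 10 <= v - 1.
    Conversely, a disjoint union of trades on v1 and v2 points is a trade on
    v1 + v2 points, and 12, 15 and 21 generate every multiple of 3 that is at
    least 12, except 18.  For v = 12 one takes three pairwise disjoint
    3-GDDs of type 2^6; for v = 3n with n = 5, 7, the blocks are the triples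
    (row, column, symbol) of a 3-way Latin trade invariant under the diagonal
    action of Z_n. *)
Require Import Defs.
From mathcomp Require Import all_boot.
From mathcomp Require Import zify.

Set Implicit Arguments.
Unset Strict Implicit.
Unset Printing Implicit Defensive.

(** * Necessary conditions by double counting *)

Section DoubleCounting.

Variable V : finType.
Implicit Types (A B : {set V}) (C : {set {set V}}).

(** Both sides count the pairs [(y, B)] with [y] in [A] and in [B]. Taking [A = setT] yields the
    volume, [A = [set~ x]] the bound on the order. *)
Lemma sum_degree C A :
  \sum_(y in A) #|[set B in C | y \in B]| = \sum_(B in C) #|B :&: A|.
Proof.
under eq_bigr do rewrite -sum1dep_card big_mkcondr /=.
rewrite exchange_big /=; apply: eq_bigr => B _.
rewrite -big_mkcondr sum1_card; apply: eq_card => y.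
by rewrite !inE andbC.
Qed.

Variables (mu k d m : nat) (T : 'I_mu -> {set {set V}}).

Lemma homogeneous_volume t (i : 'I_mu) :
  is_trade k t m T -> homogeneous d T -> d * #|V| = k * m.
Proof.
case=> _ _ cardT cardB _ homT; have := sum_degree (T i) setT.
under eq_bigr do rewrite homT.
under [RHS]eq_bigr => B TB do rewrite setIT (cardB _ _ TB).
by rewrite !sum_nat_const cardsT cardT mulnC [RHS]mulnC => ->.
Qed.

Lemma homogeneous_found (i : 'I_mu) : 0 < d -> homogeneous d T -> found T = setT.
Proof.
move=> d_gt0 homT; apply/setP=> x; rewrite inE.
move: d_gt0; rewrite -(homT x i) => /card_gt0P[B]; rewrite inE => /andP[TB xB].
by apply/bigcupP; exists i => //; apply/bigcupP; exists B.
Qed.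

Lemma homogeneous_steiner_bound (i : 'I_mu) (x : V) :
  0 < d -> is_steiner_trade k 2 m T -> homogeneous d T -> d * k.-1 <= #|V|.-1.
Proof.
move=> d_gt0 [[_ _ _ cardB _] steinerT] homT.
have := sum_degree [set B in T i | x \in B] [set~ x].
have -> : \sum_(B in [set B in T i | x \in B]) #|B :&: [set~ x]| = d * k.-1.
  rewrite -(homT x i) -sum_nat_const; apply: eq_bigr => B; rewrite inE.
  by case/andP=> TB xB; rewrite -setDE -(cardB _ _ TB) (cardsD1 x B) xB.
move=> <-; rewrite -(cardsC1 x) -sum1_card; apply: leq_sum => y.
rewrite !inE => yx; have S2 : #|[set x; y]| = 2 by rewrite cards2 eq_sym yx.
(* The Steiner condition only concerns subsets of the foundation; homogeneity with [0 < d] makes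
   that all of [V], so any pair [x], [y] qualifies. *)
have := steinerT [set x; y]; rewrite (homogeneous_found i d_gt0 homT).
move=> /(_ (subsetT _) S2 i); apply: leq_trans; apply: subset_leq_card.
apply/subsetP=> B; rewrite !inE subUset !sub1set => /andP[/andP[-> ->] ->].
by [].
Qed.

End DoubleCounting.

(** * Disjoint unions of trades *)

Section DisjointUnion.

Variables V1 V2 : finType.
Implicit Types (C : {set {set V1}}) (D : {set {set V2}}).

Definition sum_blocks C D : {set {set V1 + V2}} :=
  [set inl @: (B : {set V1}) | B in C] :|: [set inr @: (B : {set V2}) | B in D].

Lemma inl_imset_inj : injective (fun B : {set V1} => [set (inl x : V1 + V2) | x in B]).
Proof. by apply: imset_inj => x y []. Qed.

Lemma inr_imset_inj : injective (fun B : {set V2} => [set (inr x : V1 + V2) | x in B]).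
Proof. by apply: imset_inj => x y []. Qed.

Lemma mem_inl_inl (B : {set V1}) x : (inl x \in [set (inl y : V1 + V2) | y in B]) = (x \in B).
Proof. by rewrite mem_imset // => ? ? []. Qed.

Lemma mem_inr_inr (B : {set V2}) x : (inr x \in [set (inr y : V1 + V2) | y in B]) = (x \in B).
Proof. by rewrite mem_imset // => ? ? []. Qed.

Lemma mem_inl_inr (B : {set V2}) x : (inl x \in [set (inr y : V1 + V2) | y in B]) = false.
Proof. by apply/imsetP => -[]. Qed.

Lemma mem_inr_inl (B : {set V1}) x : (inr x \in [set (inl y : V1 + V2) | y in B]) = false.
Proof. by apply/imsetP => -[]. Qed.

Definition mem_sum_imset := (mem_inl_inl, mem_inr_inr, mem_inl_inr, mem_inr_inl).

Lemma inl_inr_imset (B1 : {set V1}) (B2 : {set V2}) :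
  [set (inl x : V1 + V2) | x in B1] = [set inr x | x in B2] -> B1 = set0 /\ B2 = set0.
Proof.
move=> /setP eqB; split; apply/setP => x; rewrite inE.
  by have := eqB (inl x); rewrite !mem_sum_imset.
by have := eqB (inr x); rewrite !mem_sum_imset => <-.
Qed.

(** The empty set is the only set that is an image under both injections; keeping it out of [C]
    makes the two images disjoint, so the counts add. *)
Lemma card_sum_blocks C D (P : pred {set V1 + V2}) : set0 \notin C ->
  #|[set B in sum_blocks C D | P B]|
    = #|[set B in C | P (inl @: B)]| + #|[set B in D | P (inr @: B)]|.
Proof.
move=> Cn0.
rewrite -(card_imset _ inl_imset_inj) -(card_imset _ inr_imset_inj).
rewrite -cardsUI [X in _ + X](_ : _ = 0) ?addn0; last first.
  apply/eqP; rewrite cards_eq0; apply/eqP/setP=> B; rewrite !inE.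
  apply/andP=> -[/imsetP[B1 B1_C ->] /imsetP[B2 _ /inl_inr_imset[B10 _]]].
  by move: B1_C; rewrite B10 inE (negPf Cn0).
congr #|pred_of_set _|; apply/setP=> B; rewrite !inE.
apply/andP/orP.
  case=> /orP[] /imsetP[B' CB' ->] PB; [left|right];
  by apply/imsetP; exists B' => //; rewrite inE CB'.
by case=> /imsetP[B']; rewrite inE => /andP[CB' PB'] ->; rewrite PB';
  split=> //; apply/orP; [left|right]; apply/imsetP; exists B'.
Qed.

Lemma cover_sum_blocks C D :
  cover (sum_blocks C D) = [set inl x | x in cover C] :|: [set inr x | x in cover D].
Proof.
apply/setP=> x; apply/bigcupP/setUP.
  by case=> _ /setUP[] /imsetP[B CB ->] /imsetP[y yB ->]; [left|right];
    apply: imset_f; apply/bigcupP; exists B.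
case=> /imsetP[y /bigcupP[B CB yB] ->].
  by exists (inl @: B); rewrite ?imset_f // inE imset_f.
by exists (inr @: B); rewrite ?imset_f // inE imset_f ?orbT.
Qed.

Lemma sum_set_split (S : {set V1 + V2}) :
  S = [set inl x | x in inl @^-1: S] :|: [set inr x | x in inr @^-1: S].
Proof. by apply/setP=> -[x|x]; rewrite inE !mem_sum_imset !inE ?orbF. Qed.

Lemma sub_inl_imset (S : {set V1 + V2}) (B : {set V1}) :
  (S \subset inl @: B) = (inr @^-1: S == set0) && (inl @^-1: S \subset B).
Proof.
apply/subsetP/andP=> [SB | [/eqP/setP S2 /subsetP S1] [x|x] Sx].
- split; last by apply/subsetP=> x; rewrite inE => /SB; rewrite mem_sum_imset.
  by apply/eqP/setP=> x; rewrite !inE; apply/negP=> /SB; rewrite mem_sum_imset.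
- by rewrite mem_sum_imset S1 // inE.
- by have := S2 x; rewrite !inE Sx.
Qed.

Lemma sub_inr_imset (S : {set V1 + V2}) (B : {set V2}) :
  (S \subset inr @: B) = (inl @^-1: S == set0) && (inr @^-1: S \subset B).
Proof.
apply/subsetP/andP=> [SB | [/eqP/setP S1 /subsetP S2] [x|x] Sx].
- split; last by apply/subsetP=> x; rewrite inE => /SB; rewrite mem_sum_imset.
  by apply/eqP/setP=> x; rewrite !inE; apply/negP=> /SB; rewrite mem_sum_imset.
- by have := S1 x; rewrite !inE Sx.
- by rewrite mem_sum_imset S2 // inE.
Qed.

(** Every block lies on one side, so a set meeting both sides is in no block; only the empty set
    makes both Boolean factors 1. *)
Lemma block_count_sum C D (S : {set V1 + V2}) : set0 \notin C ->
  block_count (sum_blocks C D) S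
    = (inr @^-1: S == set0) * block_count C (inl @^-1: S)
      + (inl @^-1: S == set0) * block_count D (inr @^-1: S).
Proof.
move=> Cn0; rewrite /block_count card_sum_blocks //.
have hide (T : finType) (b : bool) (E : {set {set T}}) (P : pred {set T}) :
    #|[set B in E | b && P B]| = b * #|[set B in E | P B]|.
  case: b => /=; rewrite ?mul1n // mul0n; apply: eq_card0 => B.
  by rewrite inE andbF.
rewrite -!hide; congr (_ + _); apply: eq_card => B.
  by rewrite !inE sub_inl_imset.
by rewrite !inE sub_inr_imset.
Qed.

Lemma card_sum_set (S : {set V1 + V2}) : #|S| = #|inl @^-1: S| + #|inr @^-1: S|.
Proof.
rewrite {1}[S]sum_set_split cardsU (_ : _ :&: _ = set0); last first.
  by apply/setP=> -[x|x]; rewrite inE !mem_sum_imset !inE ?andbF.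
by rewrite cards0 subn0 !card_imset //; move=> ? ? [].
Qed.

End DisjointUnion.

Lemma exists_trade_add mu d v1 v2 k t :
  exists_homogeneous_steiner_trade mu d v1 k t ->
  exists_homogeneous_steiner_trade mu d v2 k t ->
  exists_homogeneous_steiner_trade mu d (v1 + v2) k t.
Proof.
case=> V1 [m1] [T1 [cV1 [[[/andP[t0 tk] kV1] dis1 cT1 cB1 bal1] st1] hom1]].
case=> V2 [m2] [T2 [cV2 [[[_ kV2] dis2 cT2 cB2 bal2] st2] hom2]].
have n01 i : set0 \notin T1 i.
  by apply/negP=> /cB1; rewrite cards0 => k0; move: tk; rewrite -k0.
pose T i := sum_blocks (T1 i) (T2 i).
have foundl (S : {set V1 + V2}) : S \subset found T -> inl @^-1: S \subset found T1.
  move/subsetP=> Sf; apply/subsetP=> x; rewrite inE => /Sf/bigcupP[i _].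
  rewrite cover_sum_blocks inE !mem_sum_imset orbF => xT.
  by apply/bigcupP; exists i.
have foundr (S : {set V1 + V2}) : S \subset found T -> inr @^-1: S \subset found T2.
  move/subsetP=> Sf; apply/subsetP=> x; rewrite inE => /Sf/bigcupP[i _].
  rewrite cover_sum_blocks inE !mem_sum_imset /= => xT.
  by apply/bigcupP; exists i.
exists (V1 + V2)%type, (m1 + m2), T; split.
- by rewrite card_sum cV1 cV2.
- split; first split.
  + by rewrite t0 tk card_sum; split=> //; apply: leq_trans kV1 (leq_addr _ _).
  + move=> i j ij; rewrite disjoint_subset; apply/subsetP=> B TB.
    rewrite inE; apply/negP=> TB'; move: TB TB'.
    case/setUP=> /imsetP[B1 TB1 ->] /setUP[] /imsetP[B2 TB2].
    * move/inl_imset_inj=> eB; have /pred0P/(_ B1) /= := dis1 _ _ ij.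
      by rewrite TB1 eB TB2.
    * by case/inl_inr_imset=> B0; move: (n01 i); rewrite -B0 TB1.
    * by move/esym/inl_inr_imset=> [B0]; move: (n01 j); rewrite -B0 TB2.
    * move/inr_imset_inj=> eB; have /pred0P/(_ B1) /= := dis2 _ _ ij.
      by rewrite TB1 eB TB2.
  + move=> i; have := card_sum_blocks (T2 i) xpredT (n01 i).
    have setT' (U : finType) (C : {set U}) : [set B in C | true] = C.
      by apply/setP=> B; rewrite inE andbT.
    by rewrite !setT' cT1 cT2.
  + move=> i B /setUP[] /imsetP[B' TB' ->].
      by rewrite card_imset ?(cB1 i) // => ? ? [].
    by rewrite card_imset ?(cB2 i) // => ? ? [].
  + move=> S; rewrite card_sum_set => cS i j; rewrite !block_count_sum //.
    congr (_ + _); case: eqP => // S0; rewrite !mul1n.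
      by apply: bal1; rewrite -cS S0 cards0 addn0.
    by apply: bal2; rewrite -cS S0 cards0.
  + move=> S Sf cS i; rewrite block_count_sum //.
    move: cS; rewrite card_sum_set.
    case: eqP => [->|_]; case: eqP => [->|_]; rewrite ?mul0n ?mul1n ?cards0 ?addn0 ?add0n //.
    (* Both traces of [S] are empty here, which would force [t = 0]. *)
    * by move=> t0'; rewrite -t0' in t0.
    * by move=> cS; apply: st1 => //; apply: foundl.
    * by move=> cS; apply: st2 => //; apply: foundr.
- move=> x i; rewrite card_sum_blocks //.
  case: x => x.
    under eq_finset do rewrite mem_sum_imset.
    under [X in _ + #|pred_of_set X|]eq_finset do rewrite mem_sum_imset andbF.
    by rewrite hom1 (_ : [set _ | false] = set0) ?cards0 ?addn0 //; apply/setP=> B; rewrite !inE.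
  under eq_finset do rewrite mem_sum_imset andbF.
  under [X in _ + #|pred_of_set X|]eq_finset do rewrite mem_sum_imset.
  by rewrite hom2 (_ : [set _ | false] = set0) ?cards0 ?add0n //; apply/setP=> B; rewrite !inE.
Qed.

(** * Certifying explicit trades by computation *)

Section ExplicitTrades.

Definition block_of v (b : seq nat) : {set 'I_v} := [set x : 'I_v | val x \in b].

Definition blocks_of v (s : seq (seq nat)) : {set {set 'I_v}} :=
  [set B in map (@block_of v) s].

Definition pair_count (s : seq (seq nat)) x y := count (fun b => (x \in b) && (y \in b)) s.

(* Writing each block as an increasing list makes equality of blocks
   equality of lists. *)
Definition check_trade v d (T : seq (seq (seq nat))) : bool :=
  [&& all uniq T, pairwise (fun s1 s2 => ~~ has (mem s1) s2) T,
      all (fun b => [&& sorted ltn b, all (gtn v) b & size b == 3]) (flatten T),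
      all (fun s => size s == size (head [::] T)) T,
      all (fun s => all (fun x => count (fun b => x \in b) s == d) (iota 0 v)) T
    & all (fun x => all (fun y => (x != y) ==>
        let c := pair_count (head [::] T) x y in
        (c <= 1) && all (fun s => pair_count s x y == c) T) (iota 0 v)) (iota 0 v)].

(** A strictly increasing list is determined by its members, and entries below [v] all survive the
    passage to ['I_v]. *)
Lemma block_of_inj v (b c : seq nat) :
  sorted ltn b -> sorted ltn c -> all (gtn v) b -> all (gtn v) c ->
  block_of v b = block_of v c -> b = c.
Proof.
move=> sb sc /allP vb /allP vc /setP eqbc.
apply: (irr_sorted_eq ltn_trans ltnn sb sc) => x.
case: (ltnP x v) => [xv | vx].
  by have := eqbc (Ordinal xv); rewrite !inE.
by apply/idP/idP=> [/vb|/vc] /=; rewrite ltnNge vx.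
Qed.

Lemma card_blocks_of v s (P : pred {set 'I_v}) : {in s &, injective (@block_of v)} ->
  uniq s -> #|[set B in blocks_of v s | P B]| = count (P \o @block_of v) s.
Proof.
move=> injs uniqs; rewrite -count_map -size_filter -(card_uniqP _); last first.
  by rewrite filter_uniq // map_inj_in_uniq.
by apply: eq_card => B; rewrite !inE mem_filter andbC.
Qed.

Lemma check_tradeP v d T : 3 < v -> check_trade v d T ->
  exists_homogeneous_steiner_trade (size T) d v 3 2.
Proof.
move=> v3 /andP[/allP uT /and5P[/(pairwiseP [::]) dT /allP sT /allP cT /allP hT /allP pT]].
pose Ti (i : 'I_(size T)) := nth [::] T i.
have TiT i : Ti i \in T by apply: mem_nth.
have flat i b : b \in Ti i -> b \in flatten T by move=> ?; apply/flattenP; exists (Ti i).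
(* Injectivity across all lists at once serves both the counts within one collection and the
   disjointness of two collections. *)
have inj : {in flatten T &, injective (@block_of v)}.
  move=> b c /sT/and3P[sb vb _] /sT/and3P[sc vc _]; exact: block_of_inj.
have cnt i P : #|[set B in blocks_of v (Ti i) | P B]| = count (P \o @block_of v) (Ti i).
  by apply: card_blocks_of (uT _ (TiT i)) => b c /flat bT /flat; apply: inj.
have bc i x y : block_count (blocks_of v (Ti i)) [set x; y] = pair_count (Ti i) x y.
  rewrite /block_count cnt; apply: eq_count => b /=.
  by rewrite subUset !sub1set !inE.
(* The check compares every list with the first, so balance and the Steiner bound both reduce to the
   pair counts of [head [::] T]. *)
have pc x y (i : 'I_(size T)) : x != y :> 'I_v ->
    block_count (blocks_of v (Ti i)) [set x; y] = pair_count (head [::] T) x y /\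
    pair_count (head [::] T) x y <= 1.
  move=> xy; have /pT/allP/(_ (val y)) : val x \in iota 0 v by rewrite mem_iota /=.
  rewrite mem_iota /= ltn_ord => /(_ isT); rewrite xy /= => /andP[c1 /allP/(_ _ (TiT i)) /eqP c2].
  by rewrite bc c2.
exists 'I_v, (size (head [::] T)), (fun i => blocks_of v (Ti i)); split.
- exact: card_ord.
- split; first split.
  + by rewrite card_ord.
  + suff dis (i j : 'I_(size T)) : i < j -> [disjoint blocks_of v (Ti i) & blocks_of v (Ti j)].
      by move=> i j; rewrite neq_ltn => /orP[/dis | /dis]; rewrite // disjoint_sym.
    move=> /(dT i j (ltn_ord i) (ltn_ord j)) /hasPn nij.
    rewrite disjoint_sym disjoint_subset; apply/subsetP=> B; rewrite !inE => /mapP[b bj ->].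
    apply/mapP=> -[c ci] /(inj _ _ (flat _ _ bj) (flat _ _ ci)) eq_bc.
    by move: (nij _ bj); rewrite eq_bc /= ci.
  + move=> i; have := cnt i xpredT; rewrite count_predT (eqP (cT _ (TiT i))) => <-.
    by apply: eq_card => B; rewrite !inE andbT.
  + move=> i B; rewrite inE => /mapP[b /flat/sT/and3P[sb /allP vb /eqP <-] ->].
    (* All entries are below [v], so [pmap insub] drops none and the block has as many points as its
       list. *)
    have -> : block_of v b = [set x in pmap insub b].
      by apply/setP=> x; rewrite !inE mem_pmap_sub.
    rewrite cardsE (card_uniqP (pmap_sub_uniq _ (sorted_uniq ltn_trans ltnn sb))).
    by rewrite size_pmap_sub; apply/eqP; rewrite -all_count; apply/allP.
  + move=> S /eqP/cards2P[x [y [xy ->]]] i j.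
    by rewrite !(pc _ _ _ xy).1.
  + move=> S _ /eqP/cards2P[x [y [xy ->]]] i.
    by rewrite !(pc _ _ _ xy).1 (pc _ _ i xy).2.
- move=> x i; rewrite cnt.
  have /hT/allP/(_ (val x)) := TiT i; rewrite mem_iota /= => /(_ (ltn_ord x))/eqP <-.
  by apply: eq_count => b /=; rewrite inE.
Qed.

End ExplicitTrades.

(** * Base trades on 12, 15 and 21 points *)

(* The point (c, x), with [c] one of rows, columns and symbols and [x] in Z_n,
   is encoded as [c * n + x]; the cells of the array are the (r, r + j), j < 5,
   and [f] lists the symbols of row 0. *)
Definition circulant n (f : seq nat) : seq (seq nat) :=
  [seq [:: r; n + (r + j) %% n; n.*2 + (r + nth 0 f j) %% n] | r <- iota 0 n, j <- iota 0 5].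

(** The three GDDs share the groups {2i, 2i+1}, i < 6; every other pair lies in one block of
    each. *)
Definition trade12 : seq (seq (seq nat)) :=
  [:: [:: [:: 0; 2; 4]; [:: 0; 3; 5]; [:: 0; 6; 8]; [:: 0; 7; 10]; [:: 0; 9; 11];
      [:: 1; 2; 6]; [:: 1; 3; 7]; [:: 1; 4; 8]; [:: 1; 5; 11]; [:: 1; 9; 10];
      [:: 2; 5; 9]; [:: 2; 7; 11]; [:: 2; 8; 10]; [:: 3; 4; 10]; [:: 3; 6; 9];
      [:: 3; 8; 11]; [:: 4; 6; 11]; [:: 4; 7; 9]; [:: 5; 6; 10]; [:: 5; 7; 8]];
    [:: [:: 0; 2; 5]; [:: 0; 3; 4]; [:: 0; 6; 9]; [:: 0; 7; 11]; [:: 0; 8; 10];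
      [:: 1; 2; 7]; [:: 1; 3; 6]; [:: 1; 4; 9]; [:: 1; 5; 10]; [:: 1; 8; 11];
      [:: 2; 4; 11]; [:: 2; 6; 8]; [:: 2; 9; 10]; [:: 3; 5; 8]; [:: 3; 7; 10];
      [:: 3; 9; 11]; [:: 4; 6; 10]; [:: 4; 7; 8]; [:: 5; 6; 11]; [:: 5; 7; 9]];
    [:: [:: 0; 2; 6]; [:: 0; 3; 7]; [:: 0; 4; 8]; [:: 0; 5; 11]; [:: 0; 9; 10];
      [:: 1; 2; 5]; [:: 1; 3; 4]; [:: 1; 6; 10]; [:: 1; 7; 8]; [:: 1; 9; 11];
      [:: 2; 4; 10]; [:: 2; 7; 9]; [:: 2; 8; 11]; [:: 3; 5; 9]; [:: 3; 6; 11];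
      [:: 3; 8; 10]; [:: 4; 6; 9]; [:: 4; 7; 11]; [:: 5; 6; 8]; [:: 5; 7; 10]]].

Lemma exists_trade12 : exists_homogeneous_steiner_trade 3 5 12 3 2.
Proof. by apply: (@check_tradeP _ _ trade12) => //; vm_compute. Qed.

Lemma exists_trade15 : exists_homogeneous_steiner_trade 3 5 15 3 2.
Proof.
(* The three lists differ at each position [j] (disjointness), have the same set of entries
   (row-symbol pairs) and the same set of differences [f_j - j] mod [n] (column-symbol pairs). For
   [n = 5] both sets are all of Z_5. *)
pose T := map (circulant 5)
  [:: [:: 0; 2; 4; 1; 3]; [:: 1; 3; 0; 2; 4]; [:: 2; 4; 1; 3; 0]].
by apply: (@check_tradeP _ _ T) => //; vm_compute.
Qed.

Lemma exists_trade21 : exists_homogeneous_steiner_trade 3 5 21 3 2.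
Proof.
(* Here the common entries are {0, 1, 2, 4, 6} and the common differences {0, 1, 2, 3, 4}, modulo
   7. *)
pose T := map (circulant 7)
  [:: [:: 0; 2; 4; 6; 1]; [:: 1; 4; 2; 0; 6]; [:: 2; 1; 6; 4; 0]].
by apply: (@check_tradeP _ _ T) => //; vm_compute.
Qed.

(** * Generating all orders, and the equivalence *)

Lemma exists_trade_multiple3 n : 4 <= n -> n <> 6 ->
  exists_homogeneous_steiner_trade 3 5 (3 * n) 3 2.
Proof.
elim/ltn_ind: n => n IHn n4 n6.
have [n8 | n8] := ltnP n 8.
  have [->|[->|->]] : n = 4 \/ n = 5 \/ n = 7 by lia.
  - exact: exists_trade12.
  - exact: exists_trade15.
  - exact: exists_trade21.
(* Removing a 12-point trade from 30 points would leave the excluded order 18, so 30 is split as 15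
   + 15. *)
have [->|n10] := eqVneq n 10.
  exact: exists_trade_add exists_trade15 exists_trade15.
have -> : 3 * n = 12 + 3 * (n - 4) by lia.
by apply: exists_trade_add exists_trade12 (IHn _ _ _ _); lia.
Qed.

Theorem theorem3p4 (v : nat) (hv : v <> 18) :
  exists_homogeneous_steiner_trade 3 5 v 3 2 <->
  12 <= v /\ v = 0 %[mod 3].
Proof.
split=> [[V [m [T [<- steinerT homT]]]] | [v12 v3]].
  have vol := homogeneous_volume ord0 steinerT.1 homT.
  have [[_ /(leq_trans (ltn0Sn 3))/card_gt0P[x _]] _ _ _ _] := steinerT.1.
  have := homogeneous_steiner_bound ord0 x (isT : 0 < 5) steinerT homT.
  (* The bound only gives [v >= 11]; divisibility by 3, from 5v = 3m, raises it to 12. *)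
  lia.
have -> : v = 3 * (v %/ 3) by lia.
by apply: exists_trade_multiple3; lia.
Qed.
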